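(* Let $n\ge 2$, let $X=\mathcal{S}(\mathbb{R}^n)$ or $X=\mathcal{V}(\mathbb{R}^n)$, and let $T:X\to X$ be a rearrangement. If $X=\mathcal{S}(\mathbb{R}^n)$, then for all $A\in\mathcal{L}^n$ and all $\alpha,\beta\in\mathbb{R}$ with $\alpha\ge 0$, $$T(\alpha 1_A+\beta)=\alpha\,T1_A+\beta,$$ essentially. If $X=\mathcal{V}(\mathbb{R}^n)$, then the same equality holds, essentially, for all $A\in\mathcal{L}^n$ and $\alpha\ge 0$, when $\beta=0$.
   Context: $\mathcal{H}^n$ is $n$-dimensional Hausdorff (Lebesgue) measure on $\mathbb{R}^n$; ''essentially'' means up to a set of $\mathcal{H}^n$-measure zero. $\mathcal{L}^n$ is the class of $\mathcal{H}^n$-measurable subsets of $\mathbb{R}^n$ of finite $\mathcal{H}^n$-measure, and $1_A$ is the characteristic function of $A$. $\mathcal{M}(\mathbb{R}^n)$ is the set of real-valued $\mathcal{H}^n$-measurable functions on $\mathbb{R}^n$. $\mathcal{S}(\mathbb{R}^n)$ is the set of $f\in\mathcal{M}(\mathbb{R}^n)$ with $\mathcal{H}^n(\{x:f(x)>t\})<\infty$ for all real $t>\operatorname{ess\,inf} f$ (where $\operatorname{ess\,inf} f=-\infty$ is allowed). $\mathcal{V}(\mathbb{R}^n)$ is the set of nonnegative $f\in\mathcal{M}(\mathbb{R}^n)$ with $\mathcal{H}^n(\{x:f(x)>t\})<\infty$ for all $t>0$. A map $T:X\to X$ is equimeasurable if $\mathcal{H}^n(\{x:Tf(x)>t\})=\mathcal{H}^n(\{x:f(x)>t\})$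 for all $f\in X$ and $t\in\mathbb{R}$; it is monotonic if for $f,g\in X$, $f\le g$ essentially implies $Tf\le Tg$ essentially; it is a rearrangement if it is equimeasurable and monotonic. *)

(* Defs.v *)
From HB Require Import structures.
From mathcomp Require Import all_boot all_order all_algebra.
From mathcomp Require Import all_classical all_reals all_analysis ess_sup_inf.

Set Implicit Arguments.
Unset Strict Implicit.
Unset Printing Implicit Defensive.

Import Order.TTheory GRing.Theory Num.Theory.
Import numFieldNormedType.Exports.

Local Open Scope classical_set_scope.
Local Open Scope ring_scope.

Section lebesgue_outer_measure.
Context (R : realType) (n : nat).
Implicit Types (p : 'rV[R]_n * 'rV[R]_n) (A : set 'rV[R]_n).

Definition box p : set 'rV[R]_n :=
  [set x | forall i, p.1 ord0 i < x ord0 i <= p.2 ord0 i].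

(* Truncating the side lengths at 0 gives volume 0 to an empty box. *)
Definition box_volume p : R := \prod_i Num.max 0 (p.2 ord0 i - p.1 ord0 i).

Lemma box_volume_ge0 p : 0 <= box_volume p.
Proof. by apply: prodr_ge0 => i _; rewrite le_max lexx. Qed.

Definition box_cover A : set (set ('rV[R]_n * 'rV[R]_n)) :=
  [set D | countable D /\ A `<=` \bigcup_(p in D) box p].

Definition lebesgue_outer A : \bar R :=
  ereal_inf [set (\esum_(p in D) (box_volume p)%:E)%E | D in box_cover A].

Local Open Scope ereal_scope.

Let lebesgue_outer_ge0 A : 0 <= lebesgue_outer A.
Proof.
apply: le_ereal_inf_tmp => _ [D _ <-]; apply: esum_ge0 => p _.
by rewrite lee_fin box_volume_ge0.
Qed.

Let lebesgue_outer0 : lebesgue_outer set0 = 0.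
Proof.
apply/eqP; rewrite eq_le lebesgue_outer_ge0 andbT.
apply: ereal_inf_lbound; exists set0; last by rewrite esum_set0.
by split=> //; exact: countable0.
Qed.

Let le_lebesgue_outer : {homo lebesgue_outer : A B / A `<=` B >-> A <= B}.
Proof.
move=> A B AB; apply: ereal_inf_le_tmp => _ [D [cD BD] <-].
by exists D => //; split=> //; exact: subset_trans BD.
Qed.

Let esum_bigcup_le (D : (set ('rV[R]_n * 'rV[R]_n))^nat) :
  \esum_(p in \bigcup_k D k) (box_volume p)%:E <=
  \sum_(k <oo) \esum_(p in D k) (box_volume p)%:E.
Proof.
have v0 p : 0 <= (box_volume p)%:E by rewrite lee_fin box_volume_ge0.
rewrite seqDU_bigcup_eq (esum_bigcupT _ _ (@trivIset_seqDU _ D) v0).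
rewrite nneseries_esumT; last by move=> k; apply: esum_ge0 => p _; exact: v0.
apply: le_esum => k _; apply: ge_ereal_sup => _ [X [fX XD] <-].
by apply: ereal_sup_ubound; exists X => //; split=> // p Xp; exact: subset_seqDU (XD p Xp).
Qed.

Let lebesgue_outer_sigma_subadditive : sigma_subadditive lebesgue_outer.
Proof.
move=> A; have [[i ioo]|] := pselect (exists i, lebesgue_outer (A i) = +oo).
  rewrite (eseries_pinfty _ _ ioo) ?leey// => k _.
  by rewrite -ltNye (lt_le_trans _ (lebesgue_outer_ge0 _)).
rewrite -forallNE => Aoo.
apply/lee_addgt0Pr => e e0.
rewrite (le_trans _ (epsilon_trick _ _ (ltW e0)))//.
have [D PD] : {D : (set ('rV[R]_n * 'rV[R]_n))^nat & forall k,
    box_cover (A k) (D k) /\ \esum_(p in D k) (box_volume p)%:E <=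
      lebesgue_outer (A k) + (e / (2 ^ k.+1)%:R)%:E}.
  apply: (@choice _ _ (fun k E => box_cover (A k) E /\
    \esum_(p in E) (box_volume p)%:E <=
      lebesgue_outer (A k) + (e / (2 ^ k.+1)%:R)%:E)) => k.
  have fk : lebesgue_outer (A k) \is a fin_num.
    by rewrite ge0_fin_numE// ltey; exact/eqP/Aoo.
  have ek : (0 < e / (2 ^ k.+1)%:R)%R by rewrite divr_gt0// ltr0n expn_gt0.
  have [_ [E cE <-] /ltW Ele] := lb_ereal_inf_adherent ek fk.
  by exists E.
apply: (@le_trans _ _ (\esum_(p in \bigcup_k D k) (box_volume p)%:E)).
  apply: ereal_inf_lbound; exists (\bigcup_k D k) => //; split.
    by apply: bigcup_countable => // k _; exact: (PD k).1.1.
  move=> x [k _ /(PD k).1.2[p Dp xp]].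
  by exists p => //; exists k.
apply: le_trans (esum_bigcup_le D) _.
apply: lee_nneseries => k _; last exact: (PD k).2.
by move=> _; apply: esum_ge0 => p _; rewrite lee_fin box_volume_ge0.
Qed.

HB.instance Definition _ := isOuterMeasure.Build R 'rV[R]_n lebesgue_outer
  lebesgue_outer0 lebesgue_outer_ge0 le_lebesgue_outer
  lebesgue_outer_sigma_subadditive.

End lebesgue_outer_measure.

(* R^n with the sigma-algebra of Lebesgue (not only Borel) measurable sets. *)
Notation Rn R n := (caratheodory_type (@lebesgue_outer R n)).

Definition Hn (R : realType) (n : nat) : set (Rn R n) -> \bar R :=
  @lebesgue_outer R n.

HB.instance Definition _ (R : realType) (n : nat) :=
  isMeasure.Build _ (Rn R n) R (@Hn R n)
    (caratheodory_measure0 (@lebesgue_outer R n))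
    (caratheodory_measure_ge0 (mu := @lebesgue_outer R n))
    (caratheodory_measure_sigma_additive (mu := @lebesgue_outer R n)).

Section rearrangements.
Context (R : realType) (n : nat).
Implicit Types (f g : Rn R n -> R) (X : set (Rn R n -> R)).

Definition finite_measurable_sets : set (set (Rn R n)) :=
  [set A | measurable A /\ (Hn A < +oo)%E].

Definition M_space : set (Rn R n -> R) := [set f | measurable_fun setT f].

Definition S_space : set (Rn R n -> R) :=
  [set f | M_space f /\
    forall t : R, (ess_inf (@Hn R n) (EFin \o f) < t%:E)%E ->
      (Hn [set x | t < f x]%R < +oo)%E].

(* Nonnegativity is pointwise, as for functions rather than classes. *)
Definition V_space : set (Rn R n -> R) :=
  [set f | [/\ M_space f, (forall x, 0 <= f x) &
    forall t : R, 0 < t -> (Hn [set x | t < f x]%R < +oo)%E]].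

Definition ess_le f g := {ae @Hn R n, forall x, f x <= g x}.

Definition ess_eq f g := {ae @Hn R n, forall x, f x = g x}.

(* A map X -> X is encoded as a map on all functions that sends X into X;
   its values outside X are irrelevant. *)
Definition equimeasurable X (T : (Rn R n -> R) -> (Rn R n -> R)) :=
  forall f, X f -> forall t : R,
    Hn [set x | t < T f x] = Hn [set x | t < f x].

Definition monotonic X (T : (Rn R n -> R) -> (Rn R n -> R)) :=
  forall f g, X f -> X g -> ess_le f g -> ess_le (T f) (T g).

Definition rearrangement X (T : (Rn R n -> R) -> (Rn R n -> R)) :=
  equimeasurable X T /\ monotonic X T.

End rearrangements.

Arguments finite_measurable_sets : clear implicits.
Arguments M_space : clear implicits.
Arguments S_space : clear implicits.
Arguments V_space : clear implicits.

(* Main.v *)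
Require Import Defs.
From mathcomp Require Import all_boot all_order all_algebra.
From mathcomp Require Import all_classical all_reals all_analysis ess_sup_inf.
From mathcomp Require Import measurable_realfun lra.
Import Order.TTheory GRing.Theory Num.Theory.
Import numFieldNormedType.Exports.
Local Open Scope classical_set_scope.
Local Open Scope ring_scope.

(** Equimeasurability makes the image of a step function
    [alpha * \1_A + beta], with [alpha > 0], again a step function with the
    same two values: its superlevel sets decrease and, for levels [t] with
    [beta <= t < alpha + beta], all have the finite measure of [A], so they
    agree up to null sets ([ae_stepE]).  This presupposes that the image is
    essentially at least [beta], which is automatic in V for [beta = 0]; in S
    it holds because a function of S has superlevel sets of finite measure
    above its essential infimum ([S_ess_ge]).

    It remains to see that the upper set of the image does not depend on
    [alpha] and [beta].  If [beta <= beta' < alpha + beta <= alpha' + beta'],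
    then monotonicity compares the two images, and because
    [beta' < alpha + beta] the upper set of the smaller image is contained in
    the upper set of the larger one; both have the measure of [A], hence they
    agree up to a null set ([step_upper_set_eq]).  Any two value intervals are
    linked by such comparisons, through the smallest interval containing both
    ([step_upper_set_unique]). *)

(** * Superlevel sets in a measure space *)

Section superlevel_sets.
Context d (T : measurableType d) (R : realType) (mu : {measure set T -> \bar R}).
Implicit Types (A B : set T) (f g : T -> R).

Lemma measurable_superlevel f (t : R) :
  measurable_fun setT f -> measurable [set x | t < f x].
Proof.
move=> mf; have := mf measurableT _ (measurable_itv `]t, +oo[).
by rewrite setTI preimage_itvoy.
Qed.

(** Finiteness of the measure is what makes [B `\` A] null: its measure is the
    difference of two equal finite numbers. *)
Lemma ae_subset_eq_measure A B : measurable A -> measurable B ->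
  mu A = mu B -> (mu B < +oo)%E ->
  {ae mu, forall x, A x -> B x} -> {ae mu, forall x, B x -> A x}.
Proof.
move=> mA mB AB Boo subAB.
have AD0 : mu (A `\` B) = 0%E.
  apply/negligibleP; first exact: measurableD.
  by apply: negligibleS subAB => x [Ax nBx] /(_ Ax).
have AI : mu (A `&` B) = mu B.
  have : mu A = (mu (A `\` B) + mu (A `&` B))%E by exact: measureDI.
  by rewrite AB AD0 add0e.
have : mu.-negligible (B `\` A).
  apply/negligibleP; first exact: measurableD.
  have Bfin : mu B \is a fin_num by rewrite ge0_fin_numE.
  transitivity (mu B - mu (B `&` A))%E; first exact: measureD.
  by rewrite setIC AI subee.
by apply: negligibleS => x /= /not_implyP.
Qed.

(** Countably many levels approach [b] from below, so the exceptional null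
    sets can be gathered into one. *)
Lemma ae_ge_of_lt (P : T -> Prop) g (b : R) :
  (forall t, t < b -> {ae mu, forall x, P x -> t < g x}) ->
  {ae mu, forall x, P x -> b <= g x}.
Proof.
move=> H.
have : {ae mu, forall x, forall k : nat, P x -> b - k.+1%:R^-1 < g x}.
  by apply: ae_foralln => k; apply: H; rewrite ltrBlDr ltrDl invr_gt0.
apply: filterS => x Hx Px; rewrite leNgt; apply/negP => /ltr_add_invr[k].
by rewrite -ltrBrDr => /lt_trans/(_ (Hx k Px)); rewrite ltxx.
Qed.

Lemma superlevel_step A (alpha beta t : R) : beta <= t < alpha + beta ->
  [set x | t < alpha * \1_A x + beta] = A.
Proof.
move=> /andP[bt tb]; apply/seteqP; split=> x /=; rewrite indicE.
  by case: (boolP (x \in A)) => [/set_mem//|_] /=; lra.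
by move=> /mem_set -> /=; lra.
Qed.

Lemma superlevel_step_top A (alpha beta t : R) :
  0 <= alpha -> alpha + beta <= t ->
  [set x | t < alpha * \1_A x + beta] = set0.
Proof.
move=> a0 tb; apply/seteqP; split=> x //=; rewrite indicE.
by case: (x \in A) => /=; lra.
Qed.

Lemma step_ge A (alpha beta : R) x :
  0 <= alpha -> beta <= alpha * \1_A x + beta.
Proof. by move=> a0; rewrite lerDr mulr_ge0// indicE ler0n. Qed.

Lemma le_step A (alpha beta alpha' beta' : R) x :
  beta <= beta' -> alpha + beta <= alpha' + beta' ->
  alpha * \1_A x + beta <= alpha' * \1_A x + beta'.
Proof. by move=> b a; rewrite indicE; case: (x \in A) => /=; lra. Qed.

Lemma measurable_step A (alpha beta : R) : measurable A ->
  measurable_fun setT (fun x => alpha * \1_A x + beta).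
Proof.
by move=> mA; apply: measurable_funD => //; apply: measurable_funM.
Qed.

(** The superlevel sets of [g] at levels [t] with [beta <= t < alpha + beta]
    are nested and have the same finite measure, so [g] essentially takes no
    value strictly between [beta] and [alpha + beta]. *)
Lemma ae_stepE A g (alpha beta : R) : (mu A < +oo)%E ->
  measurable_fun setT g -> 0 <= alpha -> {ae mu, forall x, beta <= g x} ->
  (forall t, mu [set x | t < g x] = mu [set x | t < alpha * \1_A x + beta]) ->
  {ae mu, forall x, g x = alpha * \1_[set y | beta < g y] x + beta}.
Proof.
move=> Aoo mg a0 gb eqm.
have mgt t := measurable_superlevel g t mg.
have le_top : {ae mu, forall x, g x <= alpha + beta}.
  have : mu.-negligible [set x | alpha + beta < g x].
    apply/negligibleP; first exact: mgt.
    by apply: etrans (eqm _) _; rewrite superlevel_step_top.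
  apply: negligibleS => x /= /negP.
  by rewrite -ltNge.
have ge_top : {ae mu, forall x, beta < g x -> alpha + beta <= g x}.
  apply: ae_ge_of_lt => t tb; have [tle|tgt] := leP t beta.
    by apply: aeW => x; exact: le_lt_trans.
  have sub_t : {ae mu, forall x, t < g x -> beta < g x}.
    by apply: aeW => x; exact: lt_trans.
  have bab : beta < alpha + beta := lt_trans tgt tb.
  apply: (ae_subset_eq_measure [set x | t < g x] [set x | beta < g x]) => //.
  - by rewrite !eqm !superlevel_step ?lexx ?bab ?(ltW tgt).
  - by rewrite eqm superlevel_step ?lexx ?bab.
apply: filterS3 gb le_top ge_top => x gb gle gge.
rewrite indicE; case: (boolP (x \in _)) => [/set_mem /= /gge|/negP].
  by rewrite mulr1; lra.
rewrite mulr0 add0r => nx; apply/eqP; rewrite eq_le gb andbT leNgt.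
by apply/negP => gx; apply: nx; rewrite inE.
Qed.

End superlevel_sets.

Arguments measurable_superlevel {d T R f}.
Arguments ae_subset_eq_measure {d T R mu}.
Arguments ae_stepE {d T R mu A g alpha beta}.

(** * Rearrangements of step functions *)

Section rearranged_steps.
Local Set Implicit Arguments.
Local Unset Strict Implicit.
Context (R : realType) (n : nat).
Local Notation F := (Rn R n -> R).
Local Notation mu := (@Hn R n).
Implicit Types (A : set (Rn R n)) (f g : F) (X : set F) (T : F -> F).

(** Below [a] the superlevel sets of [g] have the measure of the whole space.
    If that is infinite, then such levels cannot exceed the essential infimum
    of [g]; if it is finite, then the complements are null. *)
Lemma S_ess_ge f g (a : R) : S_space R n g -> (forall x, a <= f x) ->
  (forall t, Hn [set x | t < g x] = Hn [set x | t < f x]) ->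
  {ae mu, forall x, a <= g x}.
Proof.
move=> [mg gfin] fa eqm.
suff : {ae mu, forall x, True -> a <= g x} by apply: filterS => x; exact.
apply: ae_ge_of_lt => t ta.
have full s : s < a -> Hn [set x | s < g x] = Hn (@setT (Rn R n)).
  move=> sa; rewrite eqm; congr Hn; apply/seteqP; split=> x //= _.
  exact: lt_le_trans (fa x).
have [Too|] := ltP (Hn (@setT (Rn R n))) +oo%E.
  apply: (ae_subset_eq_measure [set x | t < g x] setT) => //.
  - exact: measurable_superlevel.
  - exact: full.
  - exact: aeW.
rewrite leye_eq => /eqP Tyy.
(* A level strictly above [t] turns the bound by the essential infimum into a
   strict inequality. *)
pose s := (t + a) / 2.
have sa : s < a by rewrite /s; lra.
have ts : t < s by rewrite /s; lra.
have : (s%:E <= ess_inf mu (EFin \o g))%E.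
  by rewrite leNgt; apply/negP => /gfin; rewrite full// Tyy ltxx.
move=> /ess_infP; apply: filterS => x /=; rewrite lee_fin => sg _.
exact: lt_le_trans sg.
Qed.

Lemma S_step A (alpha beta : R) : finite_measurable_sets R n A -> 0 <= alpha ->
  S_space R n (fun x => alpha * \1_A x + beta).
Proof.
move=> [mA Aoo] a0; split=> [|t]; first exact: measurable_step.
have [bt _|tb] := leP beta t; last first.
  have : (beta%:E <= ess_inf mu (EFin \o (fun x => alpha * \1_A x + beta)%R))%E.
    by apply: ess_inf_ler => x; rewrite lee_fin step_ge.
  by move=> bi /(le_lt_trans bi); rewrite lte_fin ltNge (ltW tb).
have [tb|tb] := leP (alpha + beta) t.
  by rewrite superlevel_step_top// measure0.
by rewrite superlevel_step// bt tb.
Qed.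

Lemma V_step A (alpha : R) : finite_measurable_sets R n A -> 0 <= alpha ->
  V_space R n (fun x => alpha * \1_A x + 0).
Proof.
move=> [mA Aoo] a0; split=> [|x|t t0]; first exact: measurable_step.
  exact: step_ge.
have [tb|tb] := leP (alpha + 0) t.
  by rewrite superlevel_step_top// measure0.
by rewrite superlevel_step// tb (ltW t0).
Qed.

Definition step_image T A (alpha beta : R) : F :=
  T (fun x => alpha * \1_A x + beta).

Lemma step_imageE X T A (alpha beta : R) :
  set_fun X X T -> rearrangement X T -> X `<=` M_space R n ->
  (Hn A < +oo)%E -> 0 <= alpha -> X (fun x => alpha * \1_A x + beta) ->
  {ae mu, forall x, beta <= step_image T A alpha beta x} ->
  {ae mu, forall x, step_image T A alpha beta x =
    alpha * \1_[set y | beta < step_image T A alpha beta y] x + beta}.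
Proof.
move=> hT [eqm _] XM Aoo a0 Xf lf.
exact: ae_stepE Aoo (XM _ (hT _ Xf)) a0 lf (eqm _ Xf).
Qed.

(** The upper set of the smaller image is contained in that of the larger one
    since [beta' < alpha + beta], and both have the measure of [A]. *)
Lemma step_upper_set_eq X T A (alpha beta alpha' beta' : R) :
  set_fun X X T -> rearrangement X T -> X `<=` M_space R n ->
  (Hn A < +oo)%E ->
  X (fun x => alpha * \1_A x + beta) -> X (fun x => alpha' * \1_A x + beta') ->
  {ae mu, forall x, beta <= step_image T A alpha beta x} ->
  beta <= beta' -> beta' < alpha + beta -> alpha + beta <= alpha' + beta' ->
  {ae mu, forall x,
    (beta < step_image T A alpha beta x) =
    (beta' < step_image T A alpha' beta' x)}.
Proof.
move=> hT [eqm mono] XM Aoo Xf Xf' lb bb' ba aa'.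
have lvl : Hn [set x | beta < step_image T A alpha beta x] = Hn A.
  by rewrite eqm// superlevel_step// lexx; lra.
have lvl' : Hn [set x | beta' < step_image T A alpha' beta' x] = Hn A.
  by rewrite eqm// superlevel_step// lexx; lra.
have mg := XM _ (hT _ Xf); have mg' := XM _ (hT _ Xf').
have a0 : 0 <= alpha by lra.
have gE := step_imageE hT (conj eqm mono) XM Aoo a0 Xf lb.
have gg' : {ae mu, forall x,
    step_image T A alpha beta x <= step_image T A alpha' beta' x}.
  by apply: mono Xf Xf' _; apply: aeW => x; exact: le_step.
have sub : {ae mu, forall x, beta < step_image T A alpha beta x ->
    beta' < step_image T A alpha' beta' x}.
  apply: filterS2 gE gg' => x gx le_x bx.
  apply: lt_le_trans le_x; rewrite gx indicE.
  by rewrite mem_set//= mulr1.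
have sup : {ae mu, forall x, beta' < step_image T A alpha' beta' x ->
    beta < step_image T A alpha beta x}.
  apply: (ae_subset_eq_measure [set x | beta < step_image T A alpha beta x]
    [set x | beta' < step_image T A alpha' beta' x]) => //.
  - exact: measurable_superlevel.
  - exact: measurable_superlevel.
  - exact: etrans lvl (esym lvl').
  - by apply: le_lt_trans Aoo; rewrite -lvl'.
by apply: filterS2 sub sup => x h1 h2; apply/idP/idP.
Qed.

(** The step function whose values span the smallest interval containing both
    value intervals is linked to each of the two by raising the upper value
    first and lowering the lower value afterwards. *)
Lemma step_upper_set_unique X T A (alpha beta alpha' beta' : R) :
  set_fun X X T -> rearrangement X T -> X `<=` M_space R n ->
  (Hn A < +oo)%E ->
  (forall a b, 0 <= a -> b = beta \/ b = beta' ->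
    X (fun x => a * \1_A x + b) /\
    {ae mu, forall x, b <= step_image T A a b x}) ->
  0 < alpha -> 0 < alpha' ->
  {ae mu, forall x,
    (beta < step_image T A alpha beta x) =
    (beta' < step_image T A alpha' beta' x)}.
Proof.
move=> hT rT XM Aoo H a0 a0'.
pose m := Num.min beta beta'; pose M := Num.max (alpha + beta) (alpha' + beta').
have mb : m <= beta by rewrite ge_min lexx.
have mb' : m <= beta' by rewrite ge_min lexx orbT.
have aM : alpha + beta <= M by rewrite le_max lexx.
have aM' : alpha' + beta' <= M by rewrite le_max lexx orbT.
have mE : m = beta \/ m = beta' by rewrite /m; case: leP; [left|right].
have link a b : b = beta \/ b = beta' -> 0 < a -> m <= b -> a + b <= M ->
    {ae mu, forall x, (b < step_image T A a b x) =
                      (m < step_image T A (M - m) m x)}.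
  move=> hb ha hm hM.
  have [Xab lab] := H a b (ltW ha) hb.
  have Mb0 : 0 <= M - b by lra.
  have Mm0 : 0 <= M - m by lra.
  have [XMb _] := H _ _ Mb0 hb.
  have [XMm lMm] := H _ _ Mm0 mE.
  have e1 : {ae mu, forall x, (b < step_image T A a b x) =
                              (b < step_image T A (M - b) b x)}.
    by apply: (@step_upper_set_eq X) => //; lra.
  have e2 : {ae mu, forall x, (m < step_image T A (M - m) m x) =
                              (b < step_image T A (M - b) b x)}.
    by apply: (@step_upper_set_eq X) => //; lra.
  by apply: filterS2 e1 e2 => x -> ->.
have l1 := link _ _ (or_introl erefl) a0 mb aM.
have l2 := link _ _ (or_intror erefl) a0' mb' aM'.
by apply: filterS2 l1 l2 => x -> ->.
Qed.

(** Both sides are step functions with values [beta] and [alpha + beta], and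
    they have the same upper set, since that of [T \1_A] is the one belonging
    to the parameters [1] and [0].  For [alpha = 0] both sides
    are essentially the constant [beta]. *)
Lemma step_image_affine X T A (alpha beta : R) :
  set_fun X X T -> rearrangement X T -> X `<=` M_space R n ->
  (Hn A < +oo)%E ->
  (forall a b, 0 <= a -> b = beta \/ b = 0 ->
    X (fun x => a * \1_A x + b) /\
    {ae mu, forall x, b <= step_image T A a b x}) ->
  0 <= alpha ->
  ess_eq (step_image T A alpha beta) (fun x => alpha * T \1_A x + beta).
Proof.
move=> hT rT XM Aoo H a0.
have i1 : step_image T A 1 0 = T \1_A.
  by rewrite /step_image; congr T; apply/funext => x; rewrite mul1r addr0.
have [Xf lf] := H alpha beta a0 (or_introl erefl).
have [Xi li] := H 1 0 ler01 (or_intror erefl).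
have fE := step_imageE hT rT XM Aoo a0 Xf lf.
have iE := step_imageE hT rT XM Aoo ler01 Xi li.
rewrite -i1; have [a00|an0] := eqVneq alpha 0.
  by move: fE; apply: filterS => x; rewrite a00 !mul0r.
have a_gt0 : 0 < alpha by rewrite lt_neqAle eq_sym an0.
have U := step_upper_set_unique hT rT XM Aoo H a_gt0 ltr01.
apply: filterS3 fE iE U => x fx ix ux; rewrite fx {}ix mul1r addr0 !indicE.
congr (_ * _%:R + _); congr nat_of_bool.
by apply/idP/idP => /set_mem /= h; rewrite inE /=; move: h; rewrite ux.
Qed.

End rearranged_steps.

Theorem lemma4p7 (R : realType) (n : nat) (hn : (2 <= n)%N)
    (X : set (Rn R n -> R)) (hX : X = S_space R n \/ X = V_space R n)
    (T : (Rn R n -> R) -> (Rn R n -> R)) (hT : set_fun X X T)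
    (hrearr : rearrangement X T) :
  (X = S_space R n ->
    forall (A : set (Rn R n)) (alpha beta : R),
      finite_measurable_sets R n A -> 0 <= alpha ->
      ess_eq (T (fun x => alpha * \1_A x + beta))
             (fun x => alpha * T \1_A x + beta)) /\
  (X = V_space R n ->
    forall (A : set (Rn R n)) (alpha : R),
      finite_measurable_sets R n A -> 0 <= alpha ->
      ess_eq (T (fun x => alpha * \1_A x)) (fun x => alpha * T \1_A x)).
Proof.
split=> XE A alpha.
  move=> beta fA a0; apply: (@step_image_affine _ _ X) => //.
  - by rewrite XE => f [].
  - exact: fA.2.
  move=> a b age0 _.
  have Xf : X (fun x => a * \1_A x + b) by rewrite XE; exact: S_step.
  split=> //; apply: (@S_ess_ge _ _ (fun x => a * \1_A x + b)).
  - by have := hT _ Xf; rewrite XE.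
  - by move=> x; exact: step_ge.
  - exact: hrearr.1.
move=> fA a0.
have -> : (fun x => alpha * T \1_A x) = (fun x => alpha * T \1_A x + 0).
  by apply/funext => x; rewrite addr0.
have -> : (fun x => alpha * \1_A x) = (fun x => alpha * \1_A x + 0) :> (Rn R n -> R).
  by apply/funext => x; rewrite addr0.
apply: (@step_image_affine _ _ X) => //.
- by rewrite XE => f [].
- exact: fA.2.
move=> a b age0 bE; have {b bE} -> : b = 0 by case: bE.
have Xf : X (fun x => a * \1_A x + 0) by rewrite XE; exact: V_step.
split=> //; apply: aeW => x.
by have := hT _ Xf; rewrite XE => -[_ T0 _]; exact: T0.
Qed.
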